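(* Let $0<s<1$, $\epsilon\in(0,1)$ and $u\in C^{2s+\epsilon,s+\epsilon}_{x,t,\mathrm{loc}}(\mathbb{R}^n\times\mathbb{R})\cap\mathcal{L}(\mathbb{R}^n\times\mathbb{R})$. Suppose that for some $(x^0,t_0)\in\mathbb{R}^n\times\mathbb{R}$, $u(x^0,t_0)=\max_{\mathbb{R}^n\times(-\infty,t_0]}u$. Then for every $r>0$, $$u(x^0,t_0)\le \frac{C_0}{C_{n,s}}r^{2s}(\partial_t-\Delta)^s u(x^0,t_0)+C_0r^{2s}\int_{-\infty}^{t_0-r^2}\int_{B_r^c(x^0)}\frac{u(y,\tau)e^{-\frac{|x^0-y|^2}{4(t_0-\tau)}}}{(t_0-\tau)^{\frac n2+1+s}}\,dy\,d\tau,$$ where $$C_0:=\left(\int_{-\infty}^{-1}\int_{B_1^c(0)}\frac{e^{\frac{|y|^2}{4\tau}}}{(-\tau)^{\frac n2+1+s}}\,dy\,d\tau\right)^{-1},$$ and moreover $$C_0r^{2s}\int_{-\infty}^{t_0-r^2}\int_{B_r^c(x^0)}\frac{e^{-\frac{|x^0-y|^2}{4(t_0-\tau)}}}{(t_0-\tau)^{\frac n2+1+s}}\,dy\,d\tau=1.$$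
   Context: For $0<s<1$, $(\partial_t-\Delta)^s u(x,t):=C_{n,s}\int_{-\infty}^{t}\int_{\mathbb{R}^n}\frac{u(x,t)-u(y,\tau)}{(t-\tau)^{\frac n2+1+s}}e^{-\frac{|x-y|^2}{4(t-\tau)}}\,dy\,d\tau$ (principal value in $y$), with $C_{n,s}=\frac{1}{(4\pi)^{n/2}|\Gamma(-s)|}$. $\mathcal{L}(\mathbb{R}^n\times\mathbb{R})$ is the set of $u\in L^1_{\mathrm{loc}}(\mathbb{R}^n\times\mathbb{R})$ with $\int_{-\infty}^t\int_{\mathbb{R}^n}\frac{|u(x,\tau)|e^{-\frac{|x|^2}{4(t-\tau)}}}{1+(t-\tau)^{\frac n2+1+s}}dx\,d\tau<\infty$ for all $t\in\mathbb{R}$. Parabolic Hölder space $C^{2\alpha,\alpha}_{x,t}$: for $0<\alpha\le\frac12$, $|u(x,t)-u(y,\tau)|\le C(|x-y|+|t-\tau|^{1/2})^{2\alpha}$; for $\frac12<\alpha\le1$, $u$ is $\alpha$-Hölder in $t$ uniformly in $x$ and $\nabla_xu$ is $(2\alpha-1)$-Hölder in $x$ uniformly in $t$ and $(\alpha-\frac12)$-Hölder in $t$ uniformly in $x$; for $\alpha>1$, $\partial_tu,D^2_xu\in C^{2\alpha-2,\alpha-1}_{x,t}$; ''loc'' means on compact sets. $B_r^c(x^0)=\mathbb{R}^n\setminus B_r(x^0)$. *)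

(* Defs.v *)
From HB Require Import structures.
From mathcomp Require Import all_boot all_order all_algebra.
From mathcomp Require Import all_classical all_reals all_analysis.
Set Implicit Arguments. Unset Strict Implicit. Unset Printing Implicit Defensive.
Import Order.TTheory GRing.Theory Num.Theory numFieldNormedType.Exports.
Local Open Scope classical_set_scope.
Local Open Scope ring_scope.

Definition sqn (R : realType) (n : nat) (y : 'rV[R]_n) : R :=
  \sum_(i < n) (y ord0 i) ^+ 2.
Definition edist (R : realType) (n : nat) (x y : 'rV[R]_n) : R :=
  Num.sqrt (sqn (x - y)).

(* Iterated Lebesgue integral over R^n (coordinate by coordinate).  For
   nonnegative measurable f this is the Lebesgue integral on R^n (Tonelli). *)
Fixpoint iint (R : realType) (n : nat) : ('rV[R]_n -> \bar R) -> \bar R :=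
  match n return ('rV[R]_n -> \bar R) -> \bar R with
  | 0 => fun f => f 0
  | k.+1 => fun f =>
      (\int[@lebesgue_measure R]_(x in [set: R])
          iint (fun v : 'rV[R]_k => f (row_mx (const_mx x : 'rV[R]_1) v)))%E
  end.

Definition nnint (R : realType) (n : nat) (F : 'rV[R]_n -> R -> \bar R) : \bar R :=
  (\int[@lebesgue_measure R]_(tau in [set: R]) iint (fun y => F y tau))%E.

Definition sint (R : realType) (n : nat) (F : 'rV[R]_n -> R -> R) : \bar R :=
  (nnint (fun y tau => (Num.max (F y tau) 0)%:E)
   - nnint (fun y tau => (Num.max (- F y tau) 0)%:E))%E.

Definition expo (R : realType) (n : nat) (s : R) : R := n%:R / 2 + 1 + s.

Definition hkern (R : realType) (n : nat) (s : R) (x : 'rV[R]_n) (t : R)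
    (y : 'rV[R]_n) (tau : R) : R :=
  expR (- sqn (x - y) / (4 * (t - tau))) / (t - tau) `^ expo n s.

(* Euler Gamma function for a > 0, and Gamma(-s) for 0 < s < 1 via the
   functional equation Gamma(z+1) = z Gamma(z) (analytic continuation). *)
Definition Gamma (R : realType) (a : R) : R :=
  fine (\int[@lebesgue_measure R]_(x in [set: R])
          (if 0 < x then x `^ (a - 1) * expR (- x) else 0)%:E)%E.
Definition Gamma_neg (R : realType) (s : R) : R := Gamma (1 - s) / (- s).

Definition Cns (R : realType) (n : nat) (s : R) : R :=
  1 / ((4 * pi) `^ (n%:R / 2) * `|Gamma_neg s|).

Definition frac_trunc (R : realType) (n : nat) (s : R)
    (u : 'rV[R]_n -> R -> R) (x : 'rV[R]_n) (t delta : R) : \bar R :=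
  sint (fun y tau => if (tau < t) && (delta ^+ 2 < sqn (x - y))
                     then (u x t - u y tau) * hkern s x t y tau else 0).

Definition fracheat (R : realType) (n : nat) (s : R)
    (u : 'rV[R]_n -> R -> R) (x : 'rV[R]_n) (t : R) : \bar R :=
  ((Cns n s)%:E * lim (frac_trunc s u x t @ 0%R^'+))%E.

Definition L1loc (R : realType) (n : nat) (u : 'rV[R]_n -> R -> R) : Prop :=
  forall Rad : R, 0 < Rad ->
    (nnint (fun x tau => (if (sqn x <= Rad ^+ 2) && (`|tau| <= Rad)
                          then `|u x tau| else 0)%:E) < +oo)%E.
Definition classL (R : realType) (n : nat) (s : R) (u : 'rV[R]_n -> R -> R) : Prop :=
  L1loc u /\
  forall t : R,
    (nnint (fun x tau => (if tau < t then
        `|u x tau| * expR (- sqn x / (4 * (t - tau)))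
          / (1 + (t - tau) `^ expo n s) else 0)%:E) < +oo)%E.

(* Parabolic Hoelder spaces, local version.  "on compact sets" is expressed
   with the exhausting family of compact boxes {|x| <= Rad, |t| <= Rad}. *)
Definition inbox (R : realType) (n : nat) (Rad : R) (x : 'rV[R]_n) (t : R) : bool :=
  (sqn x <= Rad ^+ 2) && (`|t| <= Rad).

Definition ei (R : realType) (n : nat) (i : 'I_n) : 'rV[R]_n := delta_mx ord0 i.

Definition pdx (R : realType) (n : nat) (i : 'I_n) (f : 'rV[R]_n -> R -> R)
    : 'rV[R]_n -> R -> R :=
  fun x t => 'D_(ei R i) (fun y => f y t) x.
Definition pdt (R : realType) (n : nat) (f : 'rV[R]_n -> R -> R)
    : 'rV[R]_n -> R -> R :=
  fun x t => 'D_1 (fun tau : R => f x tau) t.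

Definition hol_joint (R : realType) (n : nat) (a : R) (f : 'rV[R]_n -> R -> R) :=
  forall Rad : R, 0 < Rad -> exists C : R, forall x y t tau,
    inbox Rad x t -> inbox Rad y tau ->
    `|f x t - f y tau| <= C * (edist x y + Num.sqrt `|t - tau|) `^ (2 * a).
Definition hol_t (R : realType) (n : nat) (a : R) (f : 'rV[R]_n -> R -> R) :=
  forall Rad : R, 0 < Rad -> exists C : R, forall x t tau,
    inbox Rad x t -> inbox Rad x tau ->
    `|f x t - f x tau| <= C * `|t - tau| `^ a.
Definition hol_x (R : realType) (n : nat) (b : R) (f : 'rV[R]_n -> R -> R) :=
  forall Rad : R, 0 < Rad -> exists C : R, forall x y t,
    inbox Rad x t -> inbox Rad y t ->
    `|f x t - f y t| <= C * edist x y `^ b.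

(* parholder k a f : f in C^{2a,a}_{x,t,loc}, with k a fuel bounding the
   number of recursive steps in the case a > 1 *)
Fixpoint parholder (R : realType) (n : nat) (k : nat) (a : R)
    (f : 'rV[R]_n -> R -> R) {struct k} : Prop :=
  if a <= 1 / 2 then 0 < a /\ hol_joint a f
  else if a <= 1 then
    hol_t a f /\
    (forall x t i, derivable (fun y => f y t) x (ei R i)) /\
    (forall i, hol_x (2 * a - 1) (pdx i f) /\ hol_t (a - 1 / 2) (pdx i f))
  else match k with
  | 0 => False
  | k'.+1 =>
    (forall x t, derivable (fun tau : R => f x tau) t 1) /\
    (forall x t i, derivable (fun y => f y t) x (ei R i)) /\
    (forall x t i j, derivable (fun y => pdx i f y t) x (ei R j)) /\
    parholder k' (a - 1) (pdt f) /\
    (forall i j, parholder k' (a - 1) (pdx j (pdx i f)))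
  end.

Definition ParHolderLoc (R : realType) (n : nat) (a : R) (f : 'rV[R]_n -> R -> R) : Prop :=
  exists k : nat, parholder k a f.

Definition C0 (R : realType) (n : nat) (s : R) : R :=
  (fine (nnint (fun (y : 'rV[R]_n) tau =>
     (if (tau <= -1) && (1 <= sqn y)
      then expR (sqn y / (4 * tau)) / (- tau) `^ expo n s else 0)%:E)))^-1.

Definition tail_int (R : realType) (n : nat) (s : R) (u : 'rV[R]_n -> R -> R)
    (x0 : 'rV[R]_n) (t0 r : R) : \bar R :=
  sint (fun y tau => if (tau <= t0 - r ^+ 2) && (r ^+ 2 <= sqn (x0 - y))
                     then u y tau * hkern s x0 t0 y tau else 0).

Definition kern_tail (R : realType) (n : nat) (s : R) (x0 : 'rV[R]_n) (t0 r : R)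
    : \bar R :=
  nnint (fun y tau => (if (tau <= t0 - r ^+ 2) && (r ^+ 2 <= sqn (x0 - y))
                       then hkern s x0 t0 y tau else 0)%:E).

(* Main.v *)
(* Put M = u(x0,t0) and let K be the heat kernel restricted to the tail region
   {tau <= t0 - r^2, |x0 - y| >= r}.  Since u <= M before t0, the truncations
   of the fractional operator are integrals of nonnegative functions which
   increase as delta decreases to 0, hence their limit dominates
   d = \int (M - u) K.  The parabolic scaling y = x0 + r z,
   tau = t0 + r^2 sigma gives C0 r^(2s) \int K = 1, so that
   M = C0 r^(2s) (d + \int u K), which is the claim.  Linearity of the iterated
   integrals requires joint measurability of u: the Hoelder condition makes u
   separately continuous, and a function measurable in one variable and
   continuous in the other is jointly measurable. *)
Require Import Defs.
From HB Require Import structures.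
From mathcomp Require Import all_boot all_order all_algebra.
From mathcomp Require Import all_classical all_reals all_analysis.
From mathcomp Require Import measurable_realfun ring lra.
Set Implicit Arguments. Unset Strict Implicit. Unset Printing Implicit Defensive.
Import Order.TTheory GRing.Theory Num.Theory numFieldNormedType.Exports.
Local Open Scope classical_set_scope.
Local Open Scope ring_scope.

(** * Iterated integrals and joint measurability *)

(** The integral of a nonnegative function is a supremum over the simple functions below it, so
    monotonicity holds for arbitrary such functions; iterated integrals can be compared before any
    measurability is established. *)
Lemma le_integralT d (T : measurableType d) (R : realType)
    (mu : {measure set T -> \bar R}) (f g : T -> \bar R) :
  (forall x, 0 <= f x)%E -> (forall x, f x <= g x)%E ->
  (\int[mu]_x f x <= \int[mu]_x g x)%E.
Proof.
move=> f0 fg; have g0 x : (0 <= g x)%E := le_trans (f0 x) (fg x).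
rewrite !ge0_integralTE//; apply: le_ereal_sup => _ [h /= hf <-].
by exists h => // x; exact: le_trans (hf x) (fg x).
Qed.

Lemma iint_ge0 (R : realType) n (f : 'rV[R]_n -> \bar R) :
  (forall v, 0 <= f v)%E -> (0 <= iint f)%E.
Proof.
elim: n f => [|n IH] f f0 /=; first exact: f0.
by apply: integral_ge0 => x _; exact: IH.
Qed.

Lemma le_iint (R : realType) n (f g : 'rV[R]_n -> \bar R) :
  (forall v, 0 <= f v)%E -> (forall v, f v <= g v)%E -> (iint f <= iint g)%E.
Proof.
elim: n f g => [|n IH] f g f0 fg /=; first exact: fg.
by apply: le_integralT => x; [exact: iint_ge0|exact: IH].
Qed.

Lemma nnint_ge0 (R : realType) n (F : 'rV[R]_n -> R -> \bar R) :
  (forall y t, 0 <= F y t)%E -> (0 <= nnint F)%E.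
Proof. by move=> F0; apply: integral_ge0 => x _; exact: iint_ge0. Qed.

Lemma le_nnint (R : realType) n (F G : 'rV[R]_n -> R -> \bar R) :
  (forall y t, 0 <= F y t)%E -> (forall y t, F y t <= G y t)%E ->
  (nnint F <= nnint G)%E.
Proof.
by move=> F0 FG; apply: le_integralT => t; [exact: iint_ge0|exact: le_iint].
Qed.

(** Rounding the continuous variable down to the grid of step 1/(m+1) gives functions that converge
    pointwise to [f] and depend, on each of countably many strips, on the measurable variable
    alone. *)
Lemma caratheodory_measurable d (T : measurableType d) (R : realType)
    (f : T -> R -> R) :
  (forall x, measurable_fun [set: T] (f^~ x)) ->
  (forall t, continuous (f t)) ->
  measurable_fun [set: T * R] (fun p => f p.1 p.2).
Proof.
move=> mf cf.
pose g (m : nat) (x : R) : R := (Num.floor (m.+1%:R * x))%:~R / m.+1%:R.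
apply: (@measurable_fun_cvg _ _ _ _ (fun m p => f p.1 (g m p.2))); last first.
  move=> -[t x] _ /=.
  suff gx : g m x @[m --> \oo] --> x by exact: (continuous_cvg _ (cf t x) gx).
  apply/cvgrPdist_le => e e0; near=> m.
  have m0 : (0 : R) < m.+1%:R by [].
  have /andP[h1 h2] := floor_itv (m.+1%:R * x).
  have -> : x - g m x = (m.+1%:R * x - (Num.floor (m.+1%:R * x))%:~R) / m.+1%:R.
    by rewrite mulrBl mulrAC divff ?mul1r// lt0r_neq0.
  rewrite normrM normfV (gtr0_norm m0) ler_pdivrMr// ger0_norm ?subr_ge0//.
  apply: (@le_trans _ _ 1).
    by rewrite lerBlDl; move: h2; rewrite intrD; exact: ltW.
  rewrite -ler_pdivrMl// mulr1 -[leRHS]invrK lef_pV2 ?posrE ?invr_gt0//.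
  apply: ltW.
  by near: m; exact: (near_infty_natSinv_lt (PosNum e0)).
move=> m _ Y mY; rewrite setTI.
(* On the strip where the floor equals [k] the rounded point is constant, so the preimage is a
   countable union of measurable rectangles. *)
rewrite (_ : _ @^-1` Y = \bigcup_(k : int)
   ([set p : T * R | f p.1 (k%:~R / m.+1%:R) \in Y] `&`
    [set p : T * R | k%:~R <= m.+1%:R * p.2 < (k + 1)%:~R])); last first.
  apply/seteqP; split=> [[t x]/= Yf|[t x] [k _ []] /=].
    exists (Num.floor (m.+1%:R * x)) => //; split => /=; first by rewrite inE.
    exact: floor_itv.
  by rewrite inE => Yf /floor_def kE; rewrite /g kE.
apply: countable_bigcupT_measurable => // k; apply: measurableI.
  have := measurableT_comp (mf (k%:~R / m.+1%:R)) (@measurable_fst _ _ T R).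
  move=> /(_ measurableT _ mY); rewrite setTI.
  by congr measurable; apply/seteqP; split=> p /=; rewrite inE.
have mm : measurable_fun [set: T * R] (fun p : T * R => m.+1%:R * p.2).
  by apply: measurable_funM => //; exact: measurable_snd.
rewrite (_ : [set _ | _] = (fun p : T * R => m.+1%:R * p.2) @^-1` `[k%:~R, (k+1)%:~R[%classic).
  by rewrite -[X in measurable X]setTI; exact: mm.
by apply/seteqP; split => p /=; rewrite in_itv.
Unshelve. all: by end_near. Qed.

Definition row_section (R : realType) n (T : Type) (f : T -> 'rV[R]_n.+1 -> R)
    (p : T * R) (v : 'rV[R]_n) : R :=
  f p.1 (row_mx (const_mx p.2 : 'rV[R]_1) v).

(* [f] is measurable in all variables together, for the product sigma-algebra
   on [T * R * ... * R]; the coordinates of the row vector are moved one by one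
   into the parameter space, in the order in which [iint] integrates them. *)
Fixpoint jmeasurable (R : realType) (n : nat) :
    forall d (T : measurableType d), (T -> 'rV[R]_n -> R) -> Prop :=
  match n with
  | 0 => fun d T f => measurable_fun [set: T] (fun t => f t 0)
  | k.+1 => fun d T f => @jmeasurable R k _ (T * R)%type (row_section f)
  end.

Lemma jmeasurable_comp (R : realType) n d (T : measurableType d)
    (f : T -> 'rV[R]_n -> R) (h : R -> R) :
  measurable_fun [set: R] h ->
  jmeasurable f -> jmeasurable (fun t v => h (f t v)).
Proof.
move=> mh; elim: n d T f => [|n IH] d T f /= jf; first exact: measurableT_comp.
exact: IH jf.
Qed.

Lemma jmeasurable_comp2 (R : realType) n d (T : measurableType d)
    (f g : T -> 'rV[R]_n -> R) (h : R -> R -> R) :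
  measurable_fun [set: R * R] (fun p => h p.1 p.2) ->
  jmeasurable f -> jmeasurable g -> jmeasurable (fun t v => h (f t v) (g t v)).
Proof.
move=> mh; elim: n d T f g => [|n IH] d T f g /= jf jg.
  exact: (measurableT_comp mh (measurable_fun_pair jf jg)).
exact: IH jf jg.
Qed.

Lemma jmeasurable_base (R : realType) n d (T : measurableType d) (f : T -> R) :
  measurable_fun [set: T] f -> jmeasurable (fun t (v : 'rV[R]_n) => f t).
Proof.
elim: n d T f => [|n IH] d T f //= mf.
by apply: IH; exact: measurableT_comp mf measurable_fst.
Qed.

(** Induction on the dimension: once the first coordinate has become a parameter,
    [caratheodory_measurable] gives measurability in the enlarged parameter, and continuity along
    the remaining axes is inherited. *)
Lemma jmeasurable_separately_continuous (R : realType) n d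
    (T : measurableType d) (f : T -> 'rV[R]_n -> R) :
  (forall v, measurable_fun [set: T] (f^~ v)) ->
  (forall t v i, continuous (fun h : R => f t (v + h *: ei R i))) -> jmeasurable f.
Proof.
elim: n d T f => [|n IH] d T f /= mf cf; first exact: mf.
apply: IH => [v|[t x] v i] /=.
  apply: (@caratheodory_measurable _ T R (fun t x => f t (row_mx (const_mx x : 'rV[R]_1) v))).
    by move=> x; exact: mf.
  move=> t.
  rewrite (_ : (fun x => _) =
      (fun h => f t (row_mx (const_mx 0 : 'rV[R]_1) v + h *: ei R ord0))).
    exact: cf.
  apply/funext => h; congr f; apply/rowP => j.
  rewrite /ei !mxE/=; case: splitP => k; rewrite ?mxE => jk.
    by rewrite add0r (_ : j == ord0) ?mulr1//; apply/eqP/val_inj; rewrite /= jk ord1.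
  rewrite (_ : (j == ord0) = false) ?andbF ?mulr0 ?addr0//.
  by apply/negbTE/eqP => /(congr1 val) /=; rewrite jk.
(* Axis [i] of the shortened vector is axis [lift ord0 i] of the full one. *)
rewrite (_ : (fun h => _) =
    (fun h => f t (row_mx (const_mx x : 'rV[R]_1) v + h *: ei R (lift ord0 i)))).
  exact: cf.
apply/funext => h; congr f; apply/rowP => j.
rewrite /ei !mxE/=; case: splitP => k; rewrite ?mxE => jk.
  rewrite (_ : (j == lift ord0 i) = false) ?mulr0 ?addr0//.
  by apply/negbTE/eqP => /(congr1 val) /=; rewrite jk ord1.
congr (_ + _ * _); rewrite /=; congr ((_ : bool)%:R).
apply/eqP/eqP => [ki|/(congr1 val)/=].
  by apply/val_inj; rewrite /= jk ki.
by rewrite jk => -[ki]; exact/val_inj.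
Qed.

(** * Tonelli measurability, linearity and affine substitution for iterated integrals *)

Lemma iint_measurable (R : realType) n d (T : measurableType d) (f : T -> 'rV[R]_n -> R) :
  jmeasurable f -> (forall t v, 0 <= f t v) ->
  measurable_fun [set: T] (fun t => iint (fun v => (f t v)%:E)).
Proof.
elim: n d T f => [|n IH] d T f /= jf f0; first exact/measurable_EFinP.
apply: (@measurable_fun_fubini_tonelli_F _ _ T (measurableTypeR R) R
  lebesgue_measure (fun p => iint (fun v => (row_section f p v)%:E))).
  by apply: (IH _ _ (row_section f) jf) => p v; exact: f0.
by move=> p; apply: iint_ge0 => v; rewrite lee_fin; exact: f0.
Qed.

(** Lebesgue measure is [a] times its pushforward under x -> b + a x: both agree on half-open
    intervals, which determine the measure. *)
Lemma ge0_integral_affine (R : realType) (f : R -> \bar R) (a b : R) :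
  0 < a -> measurable_fun [set: R] f -> (forall x, 0 <= f x)%E ->
  (\int[@lebesgue_measure R]_x f (b + a * x)%R =
   (a^-1)%:E * \int[@lebesgue_measure R]_x f x)%E.
Proof.
move=> a0 mf f0.
pose phi (x : measurableTypeR R) : measurableTypeR R := b + a * x.
have mphi : measurable_fun [set: measurableTypeR R] phi.
  by apply: measurable_funD => //; exact: measurable_funM.
pose nu0 : {measure set (measurableTypeR R) -> \bar R} :=
  mscale (NngNum (ltW a0)) (pushforward (@lebesgue_measure R) phi).
pose nu := nu0 mphi.
have munu A : measurable A -> lebesgue_measure A = nu A.
  apply: lebesgue_measure_unique => _ [[c e]] _ <- /=.
  rewrite /nu /nu0 /mscale /= /pushforward.
  have -> : phi @^-1` `]c, e]%classic = `](c - b) / a, (e - b) / a]%classic.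
    apply/seteqP; split => x /=; rewrite !in_itv /=;
      by rewrite /phi ltr_pdivrMr// ler_pdivlMr// ltrBlDl lerBrDl mulrC.
  rewrite !lebesgue_measure_itv/= !lte_fin ltr_pM2r ?invr_gt0// ltrD2r.
  case: ifPn => _; last by rewrite mule0.
  rewrite -EFinD -EFinD -EFinM; congr EFin; field; exact: lt0r_neq0.
have -> : (\int[@lebesgue_measure R]_x f x = \int[nu]_x f x)%E.
  by apply: eq_measure_integral => A mA _; exact: munu.
rewrite /nu /nu0 ge0_integral_mscale//= ge0_integral_pushforward//.
by rewrite preimage_setT muleA -EFinM mulVf ?mul1e// lt0r_neq0.
Qed.

Section jmeasurable_arith.
Context (R : realType) (n : nat) d (T : measurableType d).
Implicit Types f g : T -> 'rV[R]_n -> R.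

Lemma jmeasurableD f g : jmeasurable f -> jmeasurable g ->
  jmeasurable (fun t v => f t v + g t v).
Proof. by apply: (jmeasurable_comp2 (h := +%R)); exact: measurable_funD. Qed.

Lemma jmeasurableM f g : jmeasurable f -> jmeasurable g ->
  jmeasurable (fun t v => f t v * g t v).
Proof. by apply: (jmeasurable_comp2 (h := *%R)); exact: measurable_funM. Qed.

Lemma jmeasurableZ f c : jmeasurable f -> jmeasurable (fun t v => c * f t v).
Proof. by apply: (jmeasurable_comp (h := *%R c)); exact: measurable_funM. Qed.

End jmeasurable_arith.

Lemma iint_section_measurable (R : realType) n d (T : measurableType d)
    (f : T -> 'rV[R]_n.+1 -> R) t :
  jmeasurable f -> (forall t v, 0 <= f t v) ->
  measurable_fun [set: R]
    (fun x => iint (fun v => (f t (row_mx (const_mx x : 'rV[R]_1) v))%:E)).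
Proof.
move=> jf f0.
have mf' := iint_measurable (f := row_section f) jf (fun p v => f0 p.1 _).
exact: (measurableT_comp mf' (pair1_measurable t)).
Qed.

Lemma iintD (R : realType) n d (T : measurableType d) (f g : T -> 'rV[R]_n -> R) t :
  jmeasurable f -> jmeasurable g -> (forall t v, 0 <= f t v) -> (forall t v, 0 <= g t v) ->
  (iint (fun v => (f t v + g t v)%:E) =
   iint (fun v => (f t v)%:E) + iint (fun v => (g t v)%:E))%E.
Proof.
elim: n d T f g t => [|n IH] d T f g t jf jg f0 g0 //=.
rewrite -ge0_integralD//=; first last.
- exact: iint_section_measurable.
- by move=> x _; apply: iint_ge0 => v; rewrite lee_fin.
- exact: iint_section_measurable.
- by move=> x _; apply: iint_ge0 => v; rewrite lee_fin.
apply: eq_integral => x _.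
exact: (IH _ _ (row_section f) (row_section g) (t, x) jf jg
  (fun p _ => f0 p.1 _) (fun p _ => g0 p.1 _)).
Qed.

Lemma iintZ (R : realType) n d (T : measurableType d) (f : T -> 'rV[R]_n -> R) t c :
  jmeasurable f -> (forall t v, 0 <= f t v) -> 0 <= c ->
  (iint (fun v => (c * f t v)%:E) = c%:E * iint (fun v => (f t v)%:E))%E.
Proof.
elim: n d T f t => [|n IH] d T f t jf f0 c0 //=.
rewrite -ge0_integralZl_EFin//=; first last.
- exact: iint_section_measurable.
- by move=> x _; apply: iint_ge0 => v; rewrite lee_fin.
apply: eq_integral => x _.
exact: (IH _ _ (row_section f) (t, x) jf (fun p _ => f0 p.1 _)).
Qed.

(** Each coordinate contributes one factor 1/r; the translation is absorbed one coordinate at a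
    time. *)
Lemma iint_affine (R : realType) n d (T : measurableType d) (f : T -> 'rV[R]_n -> R) t
    (x0 : 'rV[R]_n) (r : R) : 0 < r ->
  jmeasurable f -> (forall t v, 0 <= f t v) ->
  (iint (fun v => (f t (x0 + r *: v)%R)%:E) = (r ^- n)%:E * iint (fun v => (f t v)%:E))%E.
Proof.
move=> r0; elim: n d T f t x0 => [|n IH] d T f t x0 jf f0 /=.
  by rewrite expr0 invr1 mul1e scaler0 addr0 (thinmx0 x0).
pose H x := iint (fun v => (f t (row_mx (const_mx x : 'rV[R]_1) v))%:E).
transitivity (\int[@lebesgue_measure R]_x ((r ^- n)%:E * H (x0 0 0 + r * x)%R))%E.
  apply: eq_integral => x _.
  rewrite -(IH _ _ (row_section f) (t, x0 0 0 + r * x)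
    (rsubmx (x0 : 'rV_(1 + n))) jf (fun p _ => f0 p.1 _))/=.
  congr iint; apply/funext => v; congr (f t _)%:E.
  apply/rowP => j; rewrite !mxE; case: splitP => k jk; rewrite !mxE.
    by rewrite (_ : j = 0)//; apply/val_inj; rewrite /= jk ord1.
  by congr (x0 _ _ + _); apply/val_inj; rewrite /= jk.
have mH : measurable_fun [set: R] H by exact: iint_section_measurable.
have H0 x : (0 <= H x)%E by apply: iint_ge0 => v; rewrite lee_fin.
rewrite ge0_integralZl_EFin//; last 2 first.
- apply: (measurableT_comp mH); apply: measurable_funD => //; exact: measurable_funM.
- by rewrite invr_ge0 exprn_ge0// ltW.
rewrite (ge0_integral_affine (x0 0 0) r0 mH)// muleA -EFinM; congr (_%:E * _)%E.
by rewrite exprS invfM mulrC.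
Qed.

(** Time is the initial parameter because [nnint] integrates over time outermost. *)
Definition st_measurable (R : realType) n (F : 'rV[R]_n -> R -> R) :=
  jmeasurable (fun t y => F y t).

Section nnint.
Context (R : realType) (n : nat).
Implicit Types F G : 'rV[R]_n -> R -> R.

Lemma nnintD F G : st_measurable F -> st_measurable G ->
  (forall y t, 0 <= F y t) -> (forall y t, 0 <= G y t) ->
  (nnint (fun y t => (F y t + G y t)%:E) =
   nnint (fun y t => (F y t)%:E) + nnint (fun y t => (G y t)%:E))%E.
Proof.
move=> jF jG F0 G0; rewrite /nnint -ge0_integralD//=; first last.
- exact: (iint_measurable jG (fun t y => G0 y t)).
- by move=> x _; apply: iint_ge0 => v; rewrite lee_fin.
- exact: (iint_measurable jF (fun t y => F0 y t)).
- by move=> x _; apply: iint_ge0 => v; rewrite lee_fin.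
apply: eq_integral => t _.
exact: (iintD (f := fun t y => F y t) (g := fun t y => G y t) t jF jG
  (fun t y => F0 y t) (fun t y => G0 y t)).
Qed.

Lemma nnintZ F c : st_measurable F -> (forall y t, 0 <= F y t) -> 0 <= c ->
  (nnint (fun y t => (c * F y t)%:E) = c%:E * nnint (fun y t => (F y t)%:E))%E.
Proof.
move=> jF F0 c0; rewrite /nnint -ge0_integralZl_EFin//=; first last.
- exact: (iint_measurable jF (fun t y => F0 y t)).
- by move=> x _; apply: iint_ge0 => v; rewrite lee_fin.
apply: eq_integral => t _; exact: (iintZ (f := fun t y => F y t) t jF (fun t y => F0 y t)).
Qed.

Lemma nnint_affine F (x0 : 'rV[R]_n) (t0 r a : R) : 0 < r -> 0 < a ->
  st_measurable F -> (forall y t, 0 <= F y t) ->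
  (nnint (fun y t => (F (x0 + r *: y) (t0 + a * t))%:E) =
   (r ^- n / a)%:E * nnint (fun y t => (F y t)%:E))%E.
Proof.
move=> r0 a0 jF F0; rewrite /nnint.
have mF := iint_measurable jF (fun t y => F0 y t).
under eq_integral do rewrite (iint_affine _ x0 r0 jF)//.
rewrite ge0_integralZl_EFin//; last 3 first.
- by move=> x _; apply: iint_ge0 => v; rewrite lee_fin.
- apply: (measurableT_comp mF); apply: measurable_funD => //; exact: measurable_funM.
- by rewrite invr_ge0 exprn_ge0// ltW.
rewrite (ge0_integral_affine t0 a0 mF) ?EFinM ?muleA// => t.
by apply: iint_ge0 => v; rewrite lee_fin.
Qed.

End nnint.

(** * One-dimensional integrals and the constant [Cns] *)

Lemma cst_le_integral (R : realType) (f : R -> \bar R) (a b c : R) :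
  0 <= c -> a <= b -> (forall x, 0 <= f x)%E ->
  (forall x, a <= x <= b -> (c%:E <= f x)%E) ->
  ((c * (b - a))%:E <= \int[@lebesgue_measure R]_x f x)%E.
Proof.
move=> c0 ab f0 cf.
have -> : (c * (b - a))%:E = (\int[@lebesgue_measure R]_(x in `[a, b]) (cst c%:E) x)%E.
  rewrite integral_cst//= lebesgue_measure_itv/= lte_fin.
  case: ltgtP ab => [_ _|//|-> _]; first by rewrite -EFinB -EFinM.
  by rewrite subrr mulr0 mule0.
rewrite integral_mkcond; apply: le_integralT => x; rewrite /patch/=.
  by case: ifP.
by case: ifPn => //; rewrite inE/= in_itv/=; exact: cf.
Qed.

Lemma integral_powR_itv (R : realType) (q a b : R) : 0 < a -> a < b -> q + 1 != 0 ->
  (\int[@lebesgue_measure R]_(x in `[a, b]) (x `^ q)%:E)%E =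
  ((b `^ (q + 1) - a `^ (q + 1)) / (q + 1))%:E.
Proof.
move=> a0 ab q1.
pose F (x : R) := (q + 1)^-1 * x `^ (q + 1).
have dF (x : R) : 0 < x -> is_derive x (1 : R) F (x `^ q).
  move=> x0.
  have := is_deriveZ (f := fun x : R => x `^ (q + 1)) (q + 1)^-1 (is_derive1_powR (q + 1) x0).
  by rewrite /GRing.scale/= mulrA mulVf// mul1r addrK.
have cF (x : R) : 0 < x -> {for x, continuous F}.
  move=> /dF dx; apply: differentiable_continuous; apply/derivable1_diffP.
  by case: dx.
have x_gt0 (x : R) : x \in `]a, b[ -> 0 < x.
  by rewrite in_itv/= => /andP[/(lt_trans a0)].
rewrite (@continuous_FTC2 _ (fun x => x `^ q) F)//.
- by rewrite -EFinB /F -mulrBr mulrC.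
- apply: derivable_within_continuous => x; rewrite in_itv/= => /andP[ax _].
  by have [] := is_derive1_powR q (lt_le_trans a0 ax).
- split.
  + by move=> x /x_gt0 /dF [].
  + exact/cvg_at_right_filter/cF.
  + exact/cvg_at_left_filter/cF/(lt_trans a0).
- by move=> x /x_gt0 /dF dx; rewrite derive1E; case: dx.
Qed.

(** Monotone convergence: a bound uniform along an increasing sequence of sets passes to the union.
    Applied to compact intervals, it bounds improper integrals. *)
Lemma integral_bigcup_le (R : realType) (F : (set R)^nat) (f : R -> R) (M : \bar R) :
  nondecreasing_seq F -> (forall i, measurable (F i)) ->
  measurable_fun [set: R] f -> (forall x, 0 <= f x) ->
  (forall i, \int[@lebesgue_measure R]_(x in F i) (f x)%:E <= M)%E ->
  (\int[@lebesgue_measure R]_(x in \bigcup_i F i) (f x)%:E <= M)%E.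
Proof.
move=> ndF mF mf f0 FM.
have mfF i : measurable_fun (F i) (fun x => (f x)%:E).
  by apply: measurable_funS measurableT _ _ => //; exact/measurable_EFinP.
have cF : (\int[@lebesgue_measure R]_(x in F i) (f x)%:E @[i --> \oo] -->
    \int[@lebesgue_measure R]_(x in \bigcup_i F i) (f x)%:E)%E.
  by apply: ge0_nondecreasing_set_cvg_integral => // i x _; rewrite lee_fin.
rewrite -(cvg_lim _ cF)//; apply: lime_le; last by apply: nearW => i; exact: FM.
by apply/cvg_ex; eexists; exact: cF.
Qed.

Lemma integral_powR_1y_le (R : realType) (s : R) : 0 < s ->
  (\int[@lebesgue_measure R]_(x in `[1%R, +oo[) (x `^ (-1 - s))%:E <= (s^-1)%:E)%E.
Proof.
move=> s0.
(* The offset 2 keeps every interval nondegenerate, as the closed formula for the integral of a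
   power requires. *)
have -> : `[1%R, +oo[%classic = \bigcup_i `[1%R, i%:R + 2%:R : R]%classic.
  apply/seteqP; split => [x|x [i _]] /=; rewrite !in_itv/=; last by case/andP => ->.
  rewrite andbT => x1; exists (Num.truncn x) => //=; rewrite in_itv/= x1/=.
  have /andP[_] := truncn_itv (le_trans ler01 x1).
  by rewrite -natr1 => /ltW/le_trans; apply; rewrite lerD2l ler1n.
apply: integral_bigcup_le => //.
- move=> i j ij; rewrite subsetEset => x /=; rewrite !in_itv/= => /andP[-> h] /=.
  by apply: le_trans h _; rewrite lerD2r ler_nat.
- by move=> x; exact: powR_ge0.
move=> i; have i1 : (1 : R) < i%:R + 2%:R by rewrite -natrD ltr1n addn2.
rewrite integral_powR_itv//; last by rewrite addrAC addNr add0r oppr_eq0 lt0r_neq0.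
rewrite addrAC addNr add0r powR1 lee_fin invrN mulrN -mulNr opprB.
rewrite ler_piMl ?invr_ge0 ?ltW// gerBl; exact: powR_ge0.
Qed.

Lemma integral_powR_01_le (R : realType) (s : R) : s < 1 ->
  (\int[@lebesgue_measure R]_(x in `]0%R, 1%R]) (x `^ (- s))%:E <= ((1 - s)^-1)%:E)%E.
Proof.
move=> s1; have s0 : 0 < 1 - s by rewrite subr_gt0.
have -> : `]0%R, 1%R]%classic = \bigcup_i `[(i.+2%:R)^-1, 1%R : R]%classic.
  apply/seteqP; split => [x|x [i _]] /=; rewrite !in_itv/=; last first.
    by case/andP => h ->; rewrite andbT; apply: lt_le_trans h; rewrite invr_gt0.
  move=> /andP[x0 x1]; exists (Num.truncn x^-1) => //=; rewrite in_itv/= x1 andbT.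
  have xV : 0 <= x^-1 by rewrite invr_ge0 ltW.
  have /andP[_ h] := truncn_itv xV.
  rewrite -[leRHS]invrK lef_pV2 ?posrE ?invr_gt0//.
  by apply: le_trans (ltW h) _; rewrite ler_nat.
apply: integral_bigcup_le => //.
- move=> i j ij; rewrite subsetEset => x /=; rewrite !in_itv/= => /andP[h ->] /=.
  by rewrite andbT; apply: le_trans h; rewrite lef_pV2 ?posrE// ler_nat.
- by move=> x; exact: powR_ge0.
move=> i; rewrite integral_powR_itv ?invr_gt0//; last 2 first.
- by rewrite invf_lt1// ltr1n.
- by rewrite addrC lt0r_neq0.
rewrite [- s + 1]addrC powR1 lee_fin ler_piMl ?invr_ge0 ?ltW// gerBl; exact: powR_ge0.
Qed.

(** From exp x = exp(x/2)^2 >= (1 + x/2)^2 >= x^2/4. The exponent is written [-1 - 1] to match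
    [integral_powR_1y_le] at s = 1. *)
Lemma expRN_le_powR (R : realType) (x : R) : 0 < x -> expR (- x) <= 4 * x `^ (-1 - 1).
Proof.
move=> x0.
rewrite (_ : -1 - 1 = - (2%:R)) ?powRN ?powR_mulrn ?(ltW x0)//; last by ring.
rewrite expRN -[leLHS]mul1r ler_pdivrMr ?expR_gt0// mulrAC ler_pdivlMr ?exprn_gt0// mul1r.
have -> : x = x / 2 + x / 2 by field.
rewrite [in leRHS]expRD.
have := expR_ge1Dx (x / 2); have := ltW x0; set e := expR _; nra.
Qed.

(** * Finiteness and positivity of the Gamma integral *)

Section Gamma.
Context (R : realType) (s : R).
Hypothesis s01 : 0 < s < 1.

Let g (x : R) : R := if 0 < x then x `^ (1 - s - 1) * expR (- x) else 0.

Let g0 x : 0 <= g x.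
Proof. by rewrite /g; case: ifP => // _; rewrite mulr_ge0 ?powR_ge0 ?expR_ge0. Qed.

(** Since [fine] sends an infinite value to 0, positivity of [Gamma] requires the integral to be
    finite as well as positive. *)
Lemma Gamma_gt0 : 0 < Gamma (1 - s).
Proof.
have /andP[s0 s1] := s01.
apply: fine_gt0; apply/andP; split.
  (* On [1, 2] both factors of the integrand are smallest at 2. *)
  apply: (@lt_le_trans _ _ ((2 `^ (- s) * expR (- 2) * (2 - 1))%:E)).
    by rewrite lte_fin !mulr_gt0 ?powR_gt0 ?expR_gt0//; lra.
  apply: cst_le_integral => //.
  - by rewrite ler1n.
  - move=> x /andP[x1 x2]; have x0 : 0 < x by lra.
    rewrite lee_fin x0 addrAC subrr add0r ler_pM ?powR_ge0 ?expR_ge0//.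
      rewrite !powRN lef_pV2 ?posrE ?powR_gt0//.
      by apply: ge0_ler_powR; rewrite ?nnegrE ?(ltW s0) ?(ltW x0).
    by rewrite ler_expR lerN2.
(* Integrable majorants: x^(-s) near 0, where the exponential is at most 1, and 4 x^(-2) at
   infinity, where x^(-s) is at most 1. *)
pose h1 : R -> \bar R := (fun x : R => (x `^ (- s))%:E) \_ `]0%R, 1%R].
pose h2 : R -> \bar R := (fun x : R => (4 * x `^ (-1 - 1))%:E) \_ `[1%R, +oo[.
apply: (@le_lt_trans _ _ (\int[@lebesgue_measure R]_x (h1 x + h2 x))%E).
  apply: le_integralT => x; first by rewrite lee_fin; exact: g0.
  rewrite /h1 /h2 /patch/= !mem_setE !in_itv/= andbT addrAC subrr add0r.
  have [x0|x0] := ltP 0 x; last first.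
    by rewrite (_ : (1 <= x) = false) ?adde0//; apply/negbTE; rewrite -ltNge; lra.
  have [x1|x1] := leP x 1.
    apply: (@le_trans _ _ (x `^ (- s))%:E).
      rewrite lee_fin ler_piMr ?powR_ge0// -expR0 ler_expR; lra.
    by rewrite leeDl//; case: ifP => // _; rewrite lee_fin mulr_ge0 ?powR_ge0.
  rewrite (ltW x1) add0e lee_fin.
  apply: le_trans (expRN_le_powR x0).
  rewrite ler_piMl ?expR_ge0// powRN invf_le1 ?powR_gt0//.
  by rewrite -(powRr0 x) ler_powR ?ltW.
have mh1 : measurable_fun [set: R] h1.
  apply/(measurable_restrictT _ _).1 => //; apply: measurable_funS measurableT _ _ => //.
  by apply/measurable_EFinP; exact: measurable_powR.
have mp : measurable_fun [set: R] (fun x : R => x `^ (-1 - 1)) by exact: measurable_powR.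
have mh2 : measurable_fun [set: R] h2.
  apply/(measurable_restrictT _ _).1 => //; apply: measurable_funS measurableT _ _ => //.
  by apply/measurable_EFinP; exact: measurable_funM.
have h10 x : (0 <= h1 x)%E by rewrite /h1 /patch; case: ifP => // _; rewrite lee_fin powR_ge0.
have h20 x : (0 <= h2 x)%E by rewrite /h2 /patch; case: ifP => // _;
  rewrite lee_fin mulr_ge0 ?powR_ge0.
rewrite ge0_integralD//= /h1 /h2 -!integral_mkcond lte_add_pinfty//.
  by apply: le_lt_trans (integral_powR_01_le s1) _; rewrite ltry.
under eq_integral do rewrite EFinM.
rewrite ge0_integralZl_EFin//; last 2 first.
- by move=> x _; rewrite lee_fin powR_ge0.
- by apply: measurable_funS measurableT _ _ => //; exact/measurable_EFinP.
apply: (@le_lt_trans _ _ (4%:E * (1^-1)%:E)%E); last by rewrite -EFinM ltry.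
by rewrite lee_pmul2l//; exact: integral_powR_1y_le.
Qed.

Lemma Cns_gt0 n : 0 < Cns n s.
Proof.
have /andP[s0 s1] := s01.
rewrite /Cns divr_gt0// mulr_gt0//; first by rewrite powR_gt0// mulr_gt0 ?pi_gt0.
rewrite normr_gt0 /Gamma_neg mulf_neq0 ?invr_eq0 ?oppr_eq0 ?lt0r_neq0//.
exact: Gamma_gt0.
Qed.

End Gamma.

(** * The tail kernel and the constant [C0] *)

Lemma sqn_ge0 (R : realType) n (y : 'rV[R]_n) : 0 <= sqn y.
Proof. by apply: sumr_ge0 => i _; exact: sqr_ge0. Qed.

Lemma sqnN (R : realType) n (y : 'rV[R]_n) : sqn (- y) = sqn y.
Proof. by apply: eq_bigr => i _; rewrite mxE sqrrN. Qed.

Lemma sqnZ (R : realType) n (y : 'rV[R]_n) r : sqn (r *: y) = r ^+ 2 * sqn y.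
Proof. by rewrite /sqn mulr_sumr; apply: eq_bigr => i _; rewrite mxE exprMn. Qed.

Lemma sqn_row_mx (R : realType) n (x : R) (v : 'rV[R]_n) :
  sqn (row_mx (const_mx x : 'rV[R]_1) v) = x ^+ 2 + sqn v.
Proof.
rewrite /sqn big_ord_recl; congr (_ ^+ 2 + _).
  by rewrite mxE; case: splitP => k; rewrite ?mxE.
apply: eq_bigr => i _; congr (_ ^+ 2); rewrite mxE; case: splitP => k ik.
  by move: (ltn_ord k); rewrite -ik.
by congr (v _ _); apply/val_inj; move: ik; rewrite /= => -[].
Qed.

(** Along a coordinate axis the squared norm is a quadratic polynomial in the step [h]; this yields
    both its continuity and the size of short displacements. *)
Lemma sqn_shift (R : realType) n (x v : 'rV[R]_n) i h :
  sqn (x - (v + h *: ei R i)) =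
  sqn (x - v) + (h * (- 2 * (x - v) ord0 i) + h * h).
Proof.
rewrite /sqn (bigD1 i)//= [in RHS](bigD1 i)//= [in RHS]addrAC; congr (_ + _).
  by rewrite !mxE !eqxx/=; ring.
by apply: eq_bigr => j /negbTE ji; rewrite !mxE ji andbF mulr0 addr0.
Qed.

Lemma jmeasurable_sqn (R : realType) n d (T : measurableType d) (x : 'rV[R]_n) :
  jmeasurable (fun (_ : T) v => sqn (x - v)).
Proof.
apply: jmeasurable_separately_continuous => // t v i.
rewrite (_ : (fun h => _) = (fun h => sqn (x - v) + (h * (- 2 * (x - v) ord0 i) + h * h))).
  move=> h; apply: cvgD; first exact: cvg_cst.
  apply: cvgD; apply: cvgM; (exact: cvg_id || exact: cvg_cst).
by apply/funext => h; exact: sqn_shift.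
Qed.

Definition tail_kernel (R : realType) n (s : R) (x0 : 'rV[R]_n) (t0 r : R)
    (y : 'rV[R]_n) (tau : R) : R :=
  if (tau <= t0 - r ^+ 2) && (r ^+ 2 <= sqn (x0 - y)) then hkern s x0 t0 y tau else 0.

Section tail_kernel.
Context (R : realType) (n : nat) (s : R).
Implicit Types (x y : 'rV[R]_n) (t tau r : R).

Lemma hkern_ge0 x0 t0 y tau : 0 <= hkern s x0 t0 y tau.
Proof. by rewrite /hkern divr_ge0 ?expR_ge0 ?powR_ge0. Qed.

Lemma tail_kernel_ge0 x0 t0 r y tau : 0 <= tail_kernel s x0 t0 r y tau.
Proof. by rewrite /tail_kernel; case: ifP => // _; exact: hkern_ge0. Qed.

Lemma jmeasurable_tail_kernel x0 t0 r : 0 < r -> st_measurable (tail_kernel s x0 t0 r).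
Proof.
move=> r0.
(* Inverses become powers with negative exponent, so that measurability of [powR] applies. The two
   forms agree on the support, where [t0 - tau] is nonnegative. *)
pose phi (tau q : R) := if (tau <= t0 - r ^+ 2) && (r ^+ 2 <= q) then
  expR (- q * (4 * (t0 - tau)) `^ (-1)) * (t0 - tau) `^ (- expo n s) else 0.
have -> : tail_kernel s x0 t0 r = fun y tau => phi tau (sqn (x0 - y)).
  apply/funext => y; apply/funext => tau; rewrite /tail_kernel /phi.
  case: ifPn => // /andP[h _]; have h0 : 0 <= t0 - tau.
    by have := sqr_ge0 r; lra.
  by rewrite /hkern powRN powR_inv1// mulr_ge0.
apply: (jmeasurable_comp2 (h := phi) (f := fun tau _ => tau)); last 2 first.
- exact: (@jmeasurable_base _ _ _ R).
- exact: jmeasurable_sqn.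
have m1 : measurable_fun [set: R * R] (fun p : R * R => p.1) := measurable_fst.
have m2 : measurable_fun [set: R * R] (fun p : R * R => p.2) := measurable_snd.
have m3 : measurable_fun [set: R * R] (fun p : R * R => t0 - p.1) by exact: measurable_funB.
rewrite /phi; apply: measurable_fun_ifT => //.
- by apply: measurable_and; apply: measurable_fun_ler.
- apply: measurable_funM.
  + apply: measurableT_comp => //; apply: measurable_funM; first exact: measurableT_comp.
    have m4 : measurable_fun [set: R * R] (fun p : R * R => 4 * (t0 - p.1)).
      exact: measurable_funM.
    exact: (measurableT_comp (measurable_powR (-1)) m4).
  + exact: (measurableT_comp (measurable_powR _) m3).
Qed.

Lemma kern_tailE x0 t0 r :
  kern_tail s x0 t0 r = nnint (fun y tau => (tail_kernel s x0 t0 r y tau)%:E).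
Proof. by []. Qed.

Lemma C0E : C0 n s = (fine (kern_tail s (0 : 'rV[R]_n) 0 1))^-1.
Proof.
rewrite /C0; congr (fine (nnint _))^-1; apply/funext => y; apply/funext => tau.
rewrite /tail_kernel expr1n !sub0r sqnN; case: ifP => // /andP[t1 _].
rewrite /hkern !sub0r sqnN; congr (expR _ / _)%:E.
by rewrite mulrN invrN mulrNN.
Qed.

(** Parabolic scaling leaves the Gaussian exponent and the shape of the region invariant; only the
    power of the elapsed time, multiplied by r^2, produces a factor. *)
Lemma tail_kernel_scaling x0 t0 r y tau : 0 < r ->
  tail_kernel s x0 t0 r (x0 + r *: y) (t0 + r ^+ 2 * tau) =
  r `^ (- (2 * expo n s)) * tail_kernel s 0 0 1 y tau.
Proof.
move=> r0; have r2 : 0 < r ^+ 2 by rewrite exprn_gt0.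
have E1 : sqn (x0 - (x0 + r *: y)) = r ^+ 2 * sqn y.
  by rewrite opprD addrA subrr sub0r sqnN sqnZ.
have E2 : t0 - (t0 + r ^+ 2 * tau) = r ^+ 2 * - tau by ring.
rewrite /tail_kernel /hkern E1 E2 !sub0r sqnN expr1n ler_pMr//.
rewrite (_ : (t0 + _ <= _) = (tau <= -1)); last first.
  by apply/idP/idP => h; [rewrite -(ler_pM2l r2); lra|have := ler_wpM2l (ltW r2) h; lra].
case: ifPn => [/andP[t1 _]|_]; last by rewrite mulr0.
have nt0 : 0 < - tau by lra.
have -> : - (r ^+ 2 * sqn y) / (4 * (r ^+ 2 * - tau)) = - sqn y / (4 * - tau).
  have tn0 : tau != 0 by rewrite lt_eqF//; lra.
  by field; rewrite tn0 lt0r_neq0.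
rewrite powRM ?ltW// (powRN r) powRrM powR_mulrn ?ltW//; set e := expR _.
by rewrite invfM mulrCA.
Qed.

(** The Jacobian r^(n+2) meets the kernel factor r^(-(n+2+2s)), leaving r^(-2s). *)
Lemma kern_tail_scaling x0 t0 r : 0 < r ->
  kern_tail s x0 t0 r = ((r `^ (- (2 * s)))%:E * kern_tail s (0 : 'rV[R]_n) 0 1)%E.
Proof.
move=> r0; have r2 : 0 < r ^+ 2 by rewrite exprn_gt0.
have := nnint_affine x0 t0 r0 r2 (jmeasurable_tail_kernel x0 t0 r0) (tail_kernel_ge0 x0 t0 r).
have -> : (fun y t => (tail_kernel s x0 t0 r (x0 + r *: y) (t0 + r ^+ 2 * t))%:E) =
    (fun y t => (r `^ (- (2 * expo n s)) * tail_kernel s 0 0 1 y t)%:E).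
  by apply/funext => y; apply/funext => t; rewrite tail_kernel_scaling.
rewrite nnintZ ?powR_ge0//; last 2 first.
- exact: jmeasurable_tail_kernel.
- exact: tail_kernel_ge0.
rewrite -!kern_tailE => /(congr1 (fun e => (r ^+ n * r ^+ 2)%:E * e)%E).
rewrite !muleA -!EFinM => E; apply/esym; move: E.
have -> : r ^+ n * r ^+ 2 * (r ^- n / r ^+ 2) = 1.
  by field; rewrite !expf_neq0 ?lt0r_neq0.
rewrite mul1e => <-; congr (_%:E * _)%E.
rewrite -exprD -powR_mulrn ?ltW// -powRD ?lt0r_neq0 ?implybT//.
by congr (_ `^ _); rewrite /expo natrD; field.
Qed.

End tail_kernel.

(** * Gaussian integrals, finiteness and positivity of the tail mass *)

Lemma ge0_integralN (R : realType) (f : R -> \bar R) :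
  measurable_fun [set: R] f -> (forall x, 0 <= f x)%E ->
  (\int[@lebesgue_measure R]_x f (- x)%R = \int[@lebesgue_measure R]_x f x)%E.
Proof.
move=> mf f0.
transitivity (\int[pushforward (@lebesgue_measure R) (-%R : _ -> measurableTypeR R)]_x f x)%E.
  by rewrite ge0_integral_pushforward// preimage_setT.
by apply: eq_measure_integral => A mA _; exact: lebesgue_measureN.
Qed.

Lemma iint0 (R : realType) n : iint (fun _ : 'rV[R]_n => 0%E) = 0%E.
Proof. by elim: n => [//|n IH] /=; apply: integral0_eq. Qed.

Lemma jmeasurable_expR_sqn (R : realType) n d (T : measurableType d) :
  jmeasurable (fun (_ : T) (v : 'rV[R]_n) => expR (- sqn v)).
Proof.
have -> : (fun (_ : T) (v : 'rV[R]_n) => expR (- sqn v)) = (fun _ v => expR (- sqn (0 - v))).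
  by apply/funext => t; apply/funext => v; rewrite sub0r sqnN.
by apply: (jmeasurable_comp (h := fun x => expR (- x)));
  [exact: measurableT_comp|exact: jmeasurable_sqn].
Qed.

(** The Gaussian factorizes over coordinates, each contributing the one-dimensional value
    sqrt(pi). *)
Lemma iint_expR_sqn (R : realType) n :
  iint (fun v : 'rV[R]_n => (expR (- sqn v))%:E) = ((Num.sqrt pi) ^+ n)%:E.
Proof.
elim: n => [|n IH] /=; first by rewrite /sqn big_ord0 oppr0 expR0 expr0.
transitivity (\int[@lebesgue_measure R]_x (((Num.sqrt pi) ^+ n)%:E * (gauss_fun x)%:E))%E.
  apply: eq_integral => x _.
  have -> : (fun v : 'rV[R]_n => (expR (- sqn (row_mx (const_mx x : 'rV[R]_1) v)))%:E) =
      (fun v => (gauss_fun x * expR (- sqn v))%:E).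
    by apply/funext => v; rewrite sqn_row_mx opprD expRD.
  rewrite (iintZ (f := fun (_ : R) v => expR (- sqn v)) 0
    (@jmeasurable_expR_sqn R n _ _) _ (expR_ge0 _)).
    by rewrite IH muleC.
  by move=> *; exact: expR_ge0.
rewrite ge0_integralZl_EFin//.
- by rewrite integralT_gauss -EFinM exprSr.
- by move=> x _; rewrite lee_fin expR_ge0.
- by apply/measurable_EFinP; exact: measurable_gauss_fun.
Qed.

(** Rescaling the standard Gaussian by 1/(2 sqrt a) gives the familiar (4 pi a)^(n/2), written here
    as an n-th power. *)
Lemma iint_heat_kernel (R : realType) n (a : R) : 0 < a ->
  iint (fun v : 'rV[R]_n => (expR (- sqn v / (4 * a)))%:E) =
  ((2 * Num.sqrt a * Num.sqrt pi) ^+ n)%:E.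
Proof.
move=> a0; have sa0 : 0 < Num.sqrt a by rewrite sqrtr_gt0.
have r0 : 0 < (2 * Num.sqrt a)^-1 by rewrite invr_gt0 mulr_gt0.
have := iint_affine (0 : R) (0 : 'rV[R]_n) r0
  (@jmeasurable_expR_sqn R n _ _) (fun _ _ => expR_ge0 _).
rewrite iint_expR_sqn -EFinM -exprVn invrK -exprMn => <-.
congr iint; apply/funext => v; rewrite add0r sqnZ exprVn exprMn sqr_sqrtr ?ltW//.
by congr (expR _)%:E; field; rewrite lt0r_neq0.
Qed.

(** The cube [1, 2]^n has unit volume, so the constant passes unchanged through every
    integration. *)
Lemma cst_le_iint (R : realType) n (f : 'rV[R]_n -> \bar R) (c : R) : 0 <= c ->
  (forall v, 0 <= f v)%E ->
  (forall v : 'rV[R]_n, (forall i, 1 <= v 0 i <= 2) -> (c%:E <= f v)%E) ->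
  (c%:E <= iint f)%E.
Proof.
elim: n f => [|n IH] f c0 f0 cf /=; first by apply: cf => -[].
have -> : c = c * (2 - 1) by ring.
apply: cst_le_integral => //; first by rewrite ler1n.
  by move=> x; exact: iint_ge0.
move=> x x12; apply: IH => // v v12; apply: cf => i.
by rewrite mxE; case: splitP => j _; rewrite ?mxE.
Qed.

Section kern_tail_base.
Context (R : realType) (n : nat) (s : R).
Let J := kern_tail s (0 : 'rV[R]_n) 0 1.

(** Integrating the Gaussian over all of space gives K (-t)^(n/2), which cancels the n/2 in the
    exponent and leaves (-t)^(-1-s), integrable on t <= -1. *)
Lemma kern_tail_fin : 0 < s -> (J < +oo)%E.
Proof.
move=> s0.
set K := (2 * Num.sqrt pi : R) ^+ n.
have K0 : 0 <= K by rewrite exprn_ge0// mulr_ge0// sqrtr_ge0.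
pose h : R -> \bar R := (fun x : R => (x `^ (-1 - s))%:E) \_ `[1%R, +oo[.
have h0 x : (0 <= h x)%E by rewrite /h /patch; case: ifP => // _; rewrite lee_fin powR_ge0.
have mh : measurable_fun [set: R] h.
  apply/(measurable_restrictT _ _).1 => //; apply: measurable_funS measurableT _ _ => //.
  by apply/measurable_EFinP; exact: measurable_powR.
have mhN : measurable_fun [set: R] (fun x => h (- x)) by exact: measurableT_comp.
apply: (@le_lt_trans _ _ (\int[@lebesgue_measure R]_x (K%:E * h (- x)%R))%E).
  apply: le_integralT => t.
    by apply: iint_ge0 => v; rewrite lee_fin; exact: tail_kernel_ge0.
  rewrite expr1n sub0r; case: (leP t (-1)) => [t1|_] /=; last first.
    by rewrite iint0 mule_ge0.
  have nt0 : 0 < - t by lra.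
  rewrite /h /patch/= mem_setE in_itv/= andbT (_ : 1 <= - t); last by lra.
  have -> : (K%:E * ((- t) `^ (-1 - s))%:E)%E =
      iint (fun v : 'rV[R]_n => ((- t) `^ (- expo n s) * expR (- sqn v / (4 * - t)))%:E).
    rewrite (iintZ (f := fun (_ : R) v => expR (- sqn v / (4 * - t))) 0)//; last 2 first.
    + have -> : (fun (_ : R) (v : 'rV[R]_n) => expR (- sqn v / (4 * - t))) =
          (fun _ v => expR (- sqn (0 - v) / (4 * - t))).
        by apply/funext => ?; apply/funext => v; rewrite sub0r sqnN.
      apply: (jmeasurable_comp (h := fun x => expR (- x / (4 * - t))));
        last exact: jmeasurable_sqn.
      by apply: measurableT_comp => //; apply: measurable_funM => //; exact: measurableT_comp.
    + exact: powR_ge0.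
    rewrite iint_heat_kernel// -!EFinM; congr EFin.
    rewrite mulrAC exprMn -/K mulrCA; congr (_ * _).
    rewrite -powR12_sqrt ?ltW// -powR_mulrn ?powR_ge0// -powRrM.
    rewrite -powRD ?(lt0r_neq0 nt0) ?implybT//.
    by congr (_ `^ _); rewrite /expo; field.
  apply: le_iint => v; first by rewrite lee_fin; case: ifP => // _; exact: hkern_ge0.
  rewrite lee_fin; case: ifP => _; last by rewrite mulr_ge0 ?powR_ge0 ?expR_ge0.
  by rewrite /hkern !sub0r sqnN powRN mulrC.
rewrite ge0_integralZl_EFin//.
rewrite (ge0_integralN mh h0) /h -integral_mkcond.
apply: (@le_lt_trans _ _ (K%:E * (s^-1)%:E)%E); last by rewrite -EFinM ltry.
by rewrite lee_wpmul2l//; exact: integral_powR_1y_le.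
Qed.

(** The kernel is bounded below on [1, 2]^n x [-2, -1]. Positive dimension puts this cube outside
    the unit ball; for n = 0 the region is empty. *)
Lemma kern_tail_gt0 : (0 < n)%N -> 0 < s -> (0 < J)%E.
Proof.
move=> n0 s0.
(* On that set sqn v <= 4n and 1 <= -t <= 2, so the Gaussian exponent is at least -n and the
   denominator at most 2^p with p = [expo n s]. *)
pose c : R := expR (- n%:R) / 2 `^ expo n s.
have p0 : 0 <= expo n s by rewrite /expo !addr_ge0 ?divr_ge0 ?(ltW s0).
have c0 : 0 < c by rewrite divr_gt0 ?expR_gt0 ?powR_gt0.
apply: (@lt_le_trans _ _ (c * (-1 - (-2)))%:E); first by rewrite lte_fin mulr_gt0//; lra.
apply: cst_le_integral; [exact: ltW|lra| |].
  by move=> t; apply: iint_ge0 => v; rewrite lee_fin; exact: tail_kernel_ge0.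
move=> t /andP[t2 t1]; apply: cst_le_iint; first exact: ltW.
  by move=> v; rewrite lee_fin; exact: tail_kernel_ge0.
move=> v v12; rewrite lee_fin /hkern !sub0r sqnN expr1n t1/=.
have -> : 1 <= sqn v.
  rewrite /sqn (bigD1 (Ordinal n0))//= -[leLHS]addr0 lerD//.
    by have /andP[h _] := v12 (Ordinal n0); rewrite expr_ge1// (le_trans _ h).
  by apply: sumr_ge0 => i _; exact: sqr_ge0.
have h4 : sqn v <= 4 * n%:R.
  have -> : 4 * n%:R = \sum_(i < n) (4 : R) by rewrite sumr_const card_ord -[RHS]mulr_natr.
  apply: ler_sum => i _; have /andP[h1 h2] := v12 i; nra.
have nt0 : 0 < - t by lra.
rewrite /c ler_pM ?expR_ge0 ?invr_ge0 ?powR_ge0//.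
  rewrite ler_expR mulNr lerN2 ler_pdivrMr ?mulr_gt0//.
  by apply: le_trans h4 _; have : (0 : R) <= n%:R by []; nra.
rewrite lef_pV2 ?posrE ?powR_gt0//; apply: ge0_ler_powR; rewrite ?nnegrE ?p0//; lra.
Qed.

Lemma C0_gt0 : (0 < n)%N -> 0 < s -> 0 < C0 n s.
Proof.
by move=> n0 s0; rewrite C0E invr_gt0 fine_gt0// kern_tail_gt0// kern_tail_fin.
Qed.

(** The tail mass at unit scale is positive and finite, so [C0] is its true inverse, and the scaling
    factor r^(-2s) cancels r^(2s). *)
Lemma C0_kern_tail (x0 : 'rV[R]_n) t0 r : (0 < n)%N -> 0 < s -> 0 < r ->
  ((C0 n s * r `^ (2 * s))%:E * kern_tail s x0 t0 r = 1)%E.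
Proof.
move=> n0 s0 r0; rewrite kern_tail_scaling// C0E -/J.
have J1 := kern_tail_gt0 n0 s0; have J2 := kern_tail_fin s0.
have JE : (fine J)%:E = J by rewrite fineK// ge0_fin_numE// ltW.
rewrite -{2}JE -!EFinM; congr EFin; rewrite powRN.
by field; rewrite !lt0r_neq0 ?powR_gt0 ?fine_gt0 ?J1.
Qed.

End kern_tail_base.

(** * Separate continuity of parabolic Hoelder functions *)

Lemma holder_continuous (R : realType) (g : R -> R) (t a C : R) : 0 < a ->
  (forall tau, `|tau - t| <= 1 -> `|g tau - g t| <= C * `|tau - t| `^ a) ->
  {for t, continuous g}.
Proof.
move=> a0 H; apply/cvgrPdist_le => e e0.
(* The constant [C] may be zero or negative; |C| + 1 is a safe positive replacement by which to
   divide. *)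
have C1 : 0 < `|C| + 1 by rewrite ltr_wpDl.
pose dl := (e / (`|C| + 1)) `^ a^-1.
have dl0 : 0 < dl by rewrite powR_gt0// divr_gt0.
near=> tau.
have d1 : `|tau - t| <= 1 by rewrite distrC; near: tau; exact: cvgr_dist_le.
have d2 : `|tau - t| <= dl by rewrite distrC; near: tau; exact: cvgr_dist_le.
rewrite distrC; apply: le_trans (H _ d1) _.
have P : `|tau - t| `^ a <= e / (`|C| + 1).
  have -> : e / (`|C| + 1) = dl `^ a.
    by rewrite /dl -powRrM mulVf ?lt0r_neq0// powRr1// divr_ge0 ?ltW.
  by apply: ge0_ler_powR; rewrite ?nnegrE ?(ltW a0) ?(ltW dl0).
apply: (@le_trans _ _ ((`|C| + 1) * `|tau - t| `^ a)).
  by rewrite ler_wpM2r ?powR_ge0//; have := ler_norm C; lra.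
by rewrite mulrC -ler_pdivlMr.
Unshelve. all: by end_near. Qed.

(** A directional derivative is the ordinary derivative at 0 of the restriction to a line, and that
    restriction is therefore continuous at 0. *)
Lemma derivable_line_continuous (R : realType) n (f : 'rV[R]_n -> R) (x v : 'rV[R]_n) :
  derivable f x v -> {for 0, continuous (fun h : R => f (x + h *: v))}.
Proof.
move=> df; apply: differentiable_continuous; apply/derivable1_diffP.
rewrite /derivable; move: df; rewrite /derivable.
set F := fun h => _; set G := fun h => _.
suff -> : F = G by [].
apply/funext => h; rewrite /F /G /= addr0 scale0r addr0 [h *: v + x]addrC.
by rewrite [h *: 1]mulr1.
Qed.

Section parabolic_holder.
Context (R : realType) (n : nat).
Implicit Types (f : 'rV[R]_n -> R -> R) (x : 'rV[R]_n) (t h a : R).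

(** Large enough for the box to contain the displacements of (x, t) of length at most 1 along time
    or one axis; being at least 1, it is bounded by its own square, which is what [inbox] compares
    with. *)
Let radius x t := 2 + 2 * (sqn x + `|t|).

Let radius_ge1 x t : 1 <= radius x t.
Proof. by rewrite /radius; have := sqn_ge0 x; have := normr_ge0 t; lra. Qed.

Let inbox_radius x t (y : 'rV[R]_n) tau : sqn y <= 2 * sqn x + 2 -> `|tau - t| <= 1 ->
  inbox (radius x t) y tau.
Proof.
move=> h1 h2; rewrite /inbox; have := sqn_ge0 x; have := normr_ge0 t => t0 x0.
apply/andP; split; last first.
  rewrite /radius; have := ler_normD (tau - t) t; rewrite subrK; lra.
have := radius_ge1 x t.
have : sqn y <= radius x t by rewrite /radius; lra.
set r := radius x t; nra.
Qed.

Let sqn_line x i h : `|h| <= 1 -> sqn (x + h *: ei R i) <= 2 * sqn x + 2.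
Proof.
move=> h1; have := sqn_shift 0 x i h; rewrite !sub0r !sqnN => ->.
have xi : (x ord0 i) ^+ 2 <= sqn x.
  by rewrite /sqn (bigD1 i)//= lerDl; apply: sumr_ge0 => j _; exact: sqr_ge0.
have hh : h ^+ 2 <= 1 by rewrite -real_normK ?num_real ?expr_le1.
rewrite !mxE; have := sqr_ge0 (h - x ord0 i); nra.
Qed.

Let edist_line x i h : Defs.edist (x + h *: ei R i) x = `|h|.
Proof.
rewrite /Defs.edist addrAC subrr add0r -[h *: _]add0r.
have := sqn_shift 0 (0 : 'rV[R]_n) i h; rewrite !sub0r sqnN => ->.
rewrite oppr0 mxE mulr0 mulr0 add0r {1}/sqn big1 ?add0r => [|j _].
  by rewrite -expr2 sqrtr_sqr.
by rewrite mxE expr0n.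
Qed.

(** For a <= 1/2 both continuities come from the joint Hoelder bound. For larger [a], spatial
    continuity along axes comes from the partial derivatives, and continuity in time from the
    Hoelder bound or the time derivative. *)
Lemma parholder_continuous k a f : 0 < a -> parholder k a f ->
  (forall x, continuous (f x)) /\
  (forall x t i, {for 0, continuous (fun h : R => f (x + h *: ei R i) t)}).
Proof.
have xbox x t tau : `|tau - t| <= 1 -> inbox (radius x t) x tau.
  by move=> h; apply: inbox_radius => //; have := sqn_ge0 x; lra.
have r0 x t : 0 < radius x t := lt_le_trans ltr01 (radius_ge1 x t).
have xb x t : inbox (radius x t) x t by apply: xbox; rewrite subrr normr0.
move=> a0 H.
have {H} : hol_joint a f \/ ((forall x, continuous (f x)) /\
    (forall x t i, derivable (fun y => f y t) x (ei R i))).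
  case: k H => [|k] /=; (case: ifPn => _; first by case=> _; left); case: ifPn => _ // [].
  - move=> ht [dx _]; right; split => // x t.
    have [C HC] := ht _ (r0 x t).
    by apply: (@holder_continuous _ _ t a C) => // tau h; exact: HC (xbox _ _ _ h) (xb x t).
  - move=> ht [dx _]; right; split => // x t.
    have [C HC] := ht _ (r0 x t).
    by apply: (@holder_continuous _ _ t a C) => // tau h; exact: HC (xbox _ _ _ h) (xb x t).
  - move=> dt [dx _]; right; split => // x t.
    by apply: differentiable_continuous; apply/derivable1_diffP.
case=> [hj|[ct dx]]; last first.
  by split => // x t i; apply: (@derivable_line_continuous _ _ (fun y => f y t)).
split => [x t|x t i]; have [C HC] := hj _ (r0 x t).
  apply: (@holder_continuous _ _ t a C) => // tau h.
  have := HC _ _ _ _ (xbox _ _ _ h) (xb x t).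
  rewrite (_ : Defs.edist x x = 0); last first.
    by rewrite /Defs.edist subrr /sqn big1 ?sqrtr0// => j _; rewrite mxE expr0n.
  by rewrite add0r -powR12_sqrt// -powRrM mulrA mulVf ?mul1r.
apply: (@holder_continuous _ _ 0 (2 * a) C) => [|h]; first by rewrite mulr_gt0.
rewrite subr0 scale0r addr0 => h1.
have := HC _ _ _ _ (@inbox_radius x t (x + h *: ei R i) t _ _) (xb x t).
rewrite edist_line subrr normr0 sqrtr0 addr0; apply => //.
exact: sqn_line.
Qed.

Lemma parholder_st_measurable a f : 0 < a -> ParHolderLoc a f -> st_measurable f.
Proof.
move=> a0 [k /(parholder_continuous a0)[ct cx]].
apply: jmeasurable_separately_continuous => [v|t v i h].
  by apply: continuous_measurable_fun; exact: ct.
(* Continuity at 0 for every base point yields continuity at [h] after moving the base point by [h]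
   along the axis. *)
suff : {for h, continuous (fun z : R => f (v + z *: ei R i) t)} by [].
rewrite continuous_shift.
rewrite (_ : _ \o _ = (fun z => f (v + h *: ei R i + z *: ei R i) t)); first exact: cx.
by apply/funext => z /=; rewrite -addrA -scalerDl [h + z]addrC.
Qed.

End parabolic_holder.

(** * The maximum point *)

Section integrability.
Context (R : realType) (n : nat) (s : R).

(** The factor multiplying |u| in the integral condition of [classL]. *)
Definition weight (t : R) (y : 'rV[R]_n) (tau : R) : R :=
  if tau < t then
    expR (- sqn y / (4 * (t - tau))) / (1 + (t - tau) `^ expo n s) else 0.

Lemma weight_ge0 t y tau : 0 <= weight t y tau.
Proof.
by rewrite /weight; case: ifP => // _; rewrite divr_ge0 ?expR_ge0 ?addr_ge0 ?powR_ge0.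
Qed.

Lemma jmeasurable_weight t : st_measurable (weight t).
Proof.
pose phi (tau q : R) := if tau < t then
  expR (- q * (4 * (t - tau)) `^ (-1)) * (1 + (t - tau) `^ expo n s) `^ (-1) else 0.
have -> : weight t = fun y tau => phi tau (sqn (0 - y)).
  apply/funext => y; apply/funext => tau; rewrite /weight /phi sub0r sqnN.
  case: ifPn => // h; have h0 : 0 <= t - tau by lra.
  by rewrite !powR_inv1 ?addr_ge0 ?powR_ge0// mulr_ge0.
apply: (jmeasurable_comp2 (h := phi) (f := fun tau _ => tau)); last 2 first.
- exact: (@jmeasurable_base _ _ _ R).
- exact: jmeasurable_sqn.
have m1 : measurable_fun [set: R * R] (fun p : R * R => p.1) := measurable_fst.
have m2 : measurable_fun [set: R * R] (fun p : R * R => p.2) := measurable_snd.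
have m3 : measurable_fun [set: R * R] (fun p : R * R => t - p.1) by exact: measurable_funB.
rewrite /phi; apply: measurable_fun_ifT => //.
- exact: measurable_fun_ltr.
- apply: measurable_funM.
  + apply: measurableT_comp => //; apply: measurable_funM; first exact: measurableT_comp.
    have m4 : measurable_fun [set: R * R] (fun p : R * R => 4 * (t - p.1)).
      exact: measurable_funM.
    exact: (measurableT_comp (measurable_powR (-1)) m4).
  + have m4 : measurable_fun [set: R * R] (fun p : R * R => 1 + (t - p.1) `^ expo n s).
      by apply: measurable_funD => //; exact: (measurableT_comp (measurable_powR _) m3).
    exact: (measurableT_comp (measurable_powR (-1)) m4).
Qed.

(* The convexity of the quadratic form trades the centre [x0] for a later time. *)
Lemma sqn_div_le (x y : 'rV[R]_n) a : 0 < a ->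
  sqn y / (a + 1) <= sqn (x - y) / a + sqn x.
Proof.
move=> a0; rewrite /sqn !mulr_suml -big_split/=; apply: ler_sum => i _.
rewrite !mxE; move: (y _ _) (x _ _) => z w.
rewrite ler_pdivrMr ?addr_gt0// -subr_ge0.
have -> : ((w - z) ^+ 2 / a + w ^+ 2) * (a + 1) - z ^+ 2 = (a * w + (w - z)) ^+ 2 / a.
  by field; rewrite lt0r_neq0.
by rewrite divr_ge0 ?sqr_ge0 ?ltW.
Qed.

(** The weight is centred at the origin and the kernel at [x0]. Evaluating the weight at time t0 + 1
    widens its Gaussian enough to absorb the shift, at the cost of exp(|x0|^2/4). *)
Lemma tail_kernel_le_weight (x0 : 'rV[R]_n) t0 r : 0 < r -> 0 < s ->
  exists2 c, 0 <= c & forall y tau,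
    tail_kernel s x0 t0 r y tau <= c * weight (t0 + 1) y tau.
Proof.
move=> r0 s0; set p := expo n s.
have p0 : 0 <= p by rewrite /p /expo !addr_ge0 ?divr_ge0 ?(ltW s0).
have r2 : 0 < r ^+ 2 by rewrite exprn_gt0.
(* With a = t0 - tau >= r^2, the two summands times a^p dominate respectively 1 and (a + 1)^p, the
   two terms of the denominator of the weight. *)
pose c2 := (r ^+ 2) `^ (- p) + (1 + (r ^+ 2)^-1) `^ p.
have c20 : 0 <= c2 by rewrite addr_ge0 ?powR_ge0.
exists (expR (sqn x0 / 4) * c2) => [|y tau]; first by rewrite mulr_ge0 ?expR_ge0.
rewrite /tail_kernel; case: ifPn => [/andP[t1 _]|_]; last first.
  by rewrite mulr_ge0 ?weight_ge0// mulr_ge0 ?expR_ge0.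
have a0 : 0 < t0 - tau by lra.
rewrite /weight /hkern (_ : tau < t0 + 1); last by lra.
have -> : t0 + 1 - tau = (t0 - tau) + 1 by ring.
have ra : r ^+ 2 <= t0 - tau by lra.
move: (t0 - tau) a0 ra => a a0 ra; rewrite mulrACA ler_pM ?expR_ge0 ?invr_ge0 ?powR_ge0//.
  rewrite -expRD ler_expR.
  have := sqn_div_le x0 y a0; rewrite !mulNr !invfM !mulrA.
  have -> : sqn y / 4 / (a + 1) = sqn y / (a + 1) / 4 by field; rewrite lt0r_neq0// addr_gt0.
  have -> : sqn (x0 - y) / 4 / a = sqn (x0 - y) / a / 4 by field; rewrite lt0r_neq0.
  lra.
have ap : 0 < a `^ p by rewrite powR_gt0.
have b0 : 0 < 1 + (a + 1) `^ p by rewrite ltr_pwDl ?powR_ge0.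
rewrite ler_pdivlMr// mulrC ler_pdivrMr// /c2 mulrDl lerD//.
  by rewrite powRN mulrC ler_pdivlMr ?powR_gt0// mul1r;
    apply: ge0_ler_powR; rewrite ?nnegrE ?(ltW a0) ?(ltW r2).
rewrite -powRM ?addr_ge0 ?invr_ge0 ?(ltW a0) ?(ltW r2)//.
apply: ge0_ler_powR => //.
- by rewrite nnegrE addr_ge0// ltW.
- by rewrite nnegrE mulr_ge0 ?addr_ge0 ?invr_ge0 ?(ltW a0) ?(ltW r2).
by rewrite mulrDl mul1r lerD2l mulrC ler_pdivlMr// mul1r.
Qed.

Lemma classL_tail_fin (u : 'rV[R]_n -> R -> R) (x0 : 'rV[R]_n) t0 r :
  0 < r -> 0 < s -> st_measurable u -> classL s u ->
  (nnint (fun y tau => (`|u y tau| * tail_kernel s x0 t0 r y tau)%:E) < +oo)%E.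
Proof.
move=> r0 s0 ju [_ /(_ (t0 + 1))].
have -> : (fun y tau => (if tau < t0 + 1 then
      `|u y tau| * expR (- sqn y / (4 * (t0 + 1 - tau)))
        / (1 + (t0 + 1 - tau) `^ expo n s) else 0)%:E) =
    (fun y tau => (`|u y tau| * weight (t0 + 1) y tau)%:E).
  apply/funext => y; apply/funext => tau; rewrite /weight.
  by case: ifP => _; rewrite ?mulr0// mulrA.
move=> wfin; have [c c0 cw] := tail_kernel_le_weight x0 t0 r0 s0.
apply: (@le_lt_trans _ _ (nnint (fun y tau => (c * (`|u y tau| * weight (t0 + 1) y tau))%:E))).
  apply: le_nnint => y tau; rewrite lee_fin.
    by rewrite mulr_ge0// tail_kernel_ge0.
  by rewrite mulrCA ler_wpM2l.
rewrite nnintZ//.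
- by rewrite lte_mul_pinfty// ?lee_fin.
- apply: jmeasurableM; last exact: jmeasurable_weight.
  by apply: (jmeasurable_comp (h := fun x => `|x|)) => //; exact: measurable_normr.
- by move=> y tau; rewrite mulr_ge0 ?weight_ge0.
Qed.

End integrability.

Lemma nnint0 (R : realType) n : nnint (fun (_ : 'rV[R]_n) _ => 0%E) = 0%E.
Proof. by rewrite /nnint; apply: integral0_eq => t _; exact: iint0. Qed.

Lemma sint_ge0E (R : realType) n (F : 'rV[R]_n -> R -> R) :
  (forall y tau, 0 <= F y tau) -> sint F = nnint (fun y tau => (F y tau)%:E).
Proof.
move=> F0; rewrite /sint.
have -> : (fun y tau => (Num.max (F y tau) 0)%:E) = (fun y tau => (F y tau)%:E).
  by apply/funext => y; apply/funext => tau; rewrite max_l.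
have -> : (fun y tau => (Num.max (- F y tau) 0)%:E) = (fun _ _ => 0%E).
  by apply/funext => y; apply/funext => tau; rewrite max_r// oppr_le0.
by rewrite nnint0 sube0.
Qed.

(** * The fractional operator and the tail integrals at a maximum point *)

Section maximum_point.
Context (R : realType) (n : nat) (s : R) (u : 'rV[R]_n -> R -> R).
Context (x0 : 'rV[R]_n) (t0 : R).
Hypothesis u_max : forall y tau, tau <= t0 -> u y tau <= u x0 t0.

Let F delta y tau : R := if (tau < t0) && (delta ^+ 2 < sqn (x0 - y))
  then (u x0 t0 - u y tau) * hkern s x0 t0 y tau else 0.

Let F_ge0 delta y tau : 0 <= F delta y tau.
Proof.
rewrite /F; case: ifP => // /andP[t1 _].
by rewrite mulr_ge0 ?hkern_ge0// subr_ge0 u_max// ltW.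
Qed.

(** The integrand is nonnegative at a maximum and its domain grows as [delta] decreases, so the
    limit at 0 from the right exists in the extended reals and is the supremum of the
    truncations. *)
Lemma frac_trunc_le_lim delta : 0 < delta ->
  (frac_trunc s u x0 t0 delta <= lim (frac_trunc s u x0 t0 @ 0%R^'+))%E.
Proof.
move=> d0.
have nif : {in Interval (BRight 0) +oo%O &, nonincreasing_fun (frac_trunc s u x0 t0)}.
  move=> a b; rewrite !in_itv/= !andbT => a0 b0 ab.
  rewrite /frac_trunc !(@sint_ge0E R n (F _)) //; apply: le_nnint => y tau; rewrite lee_fin//.
  rewrite {1}/F; case: ifPn => [/andP[t1 bq]|_]; last exact: F_ge0.
  by rewrite /F t1 (le_lt_trans _ bq)// ler_sqr ?nnegrE ?(ltW a0) ?(ltW b0).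
rewrite (cvg_lim _ (@nonincreasing_at_right_cvge R _ 0 +oo%O isT nif))//.
by apply: ereal_sup_ubound; exists delta => //=; rewrite in_itv/= d0.
Qed.

Let D r y tau := (u x0 t0 - u y tau) * tail_kernel s x0 t0 r y tau.

Let D_ge0 r y tau : 0 <= D r y tau.
Proof.
rewrite /D /tail_kernel; case: ifP => [/andP[t1 _]|_]; last by rewrite mulr0.
rewrite mulr_ge0 ?hkern_ge0// subr_ge0 u_max//; have := sqr_ge0 r; lra.
Qed.

Lemma tail_le_lim r : 0 < r ->
  (nnint (fun y tau => ((u x0 t0 - u y tau) * tail_kernel s x0 t0 r y tau)%:E)
    <= lim (frac_trunc s u x0 t0 @ 0%R^'+))%E.
Proof.
(* Truncations use a strict inequality while the tail region contains the sphere of radius [r];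
   radius r/2 covers it. *)
move=> r0; have r20 : 0 < r / 2 by rewrite divr_gt0.
apply: le_trans (frac_trunc_le_lim r20).
rewrite /frac_trunc (@sint_ge0E R n (F (r / 2)))//.
apply: le_nnint => y tau; rewrite lee_fin; first exact: D_ge0.
rewrite /tail_kernel; case: ifPn => [/andP[t1 q1]|_]; last first.
  by rewrite mulr0; exact: F_ge0.
have r2 : 0 < r ^+ 2 by rewrite exprn_gt0.
have q2 : (r / 2) ^+ 2 < sqn (x0 - y).
  by apply: lt_le_trans q1; rewrite (_ : (r / 2) ^+ 2 = r ^+ 2 / 4); [lra|field].
have t2 : tau < t0 by lra.
by rewrite /F t2 q2.
Qed.

(** This is M K = (M - u) K + u K integrated. All four integrals are shown to be real numbers, so
    that the remaining algebra takes place in [R]. *)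
Lemma nnint_tail_identity r : 0 < r -> 0 < s -> st_measurable u -> classL s u ->
  exists d p m k : R,
  [/\ nnint (fun y tau => ((u x0 t0 - u y tau) * tail_kernel s x0 t0 r y tau)%:E) = d%:E,
      tail_int s u x0 t0 r = (p - m)%:E,
      kern_tail s x0 t0 r = k%:E &
      u x0 t0 * k = d + p - m].
Proof.
move=> r0 s0 ju uL; set K := tail_kernel s x0 t0 r; set M := u x0 t0.
have jK : st_measurable K by exact: jmeasurable_tail_kernel.
have K0 : forall y tau, 0 <= K y tau by exact: tail_kernel_ge0.
pose up y tau := Num.max (u y tau * K y tau) 0.
pose um y tau := Num.max (- (u y tau * K y tau)) 0.
have up0 y tau : 0 <= up y tau by rewrite /up le_max lexx orbT.
have um0 y tau : 0 <= um y tau by rewrite /um le_max lexx orbT.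
have juK : st_measurable (fun y tau => u y tau * K y tau) by exact: jmeasurableM.
have jup : st_measurable up.
  by apply: (jmeasurable_comp (h := fun x => Num.max x 0)) juK; exact: measurable_maxr.
have jum : st_measurable um.
  by apply: (jmeasurable_comp (h := fun x => Num.max (- x) 0)) juK; exact: measurable_maxr.
have jMD : st_measurable (D r).
  apply: (jmeasurable_comp2 (h := fun x y => (M - x) * y)) ju jK.
  apply: measurable_funM; last exact: measurable_snd.
  by apply: measurable_funB => //; exact: measurable_fst.
have absfin := classL_tail_fin x0 t0 r0 s0 ju uL.
(* Domination by |u| K, integrable by the class condition, makes the integrals of the positive and
   negative parts of u K finite. *)
have fin G : (forall y tau, 0 <= G y tau) ->
    (forall y tau, G y tau <= `|u y tau| * K y tau) ->
    exists2 g, nnint (fun y tau => (G y tau)%:E) = g%:E & 0 <= g.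
  move=> G0 GK; exists (fine (nnint (fun y tau => (G y tau)%:E))).
    rewrite fineK// ge0_fin_numE; last by apply: nnint_ge0 => y tau; rewrite lee_fin.
    apply: le_lt_trans absfin; apply: le_nnint => y tau; rewrite lee_fin//.
  by apply/fine_ge0/nnint_ge0 => y tau; rewrite lee_fin.
have absK y tau : `|u y tau| * K y tau = `|u y tau * K y tau|.
  by rewrite normrM (ger0_norm (K0 _ _)).
have [p pE _] : exists2 g, nnint (fun y tau => (up y tau)%:E) = g%:E & 0 <= g.
  by apply: fin => // y tau; rewrite /up ge_max absK ler_norm normr_ge0.
have [m mE _] : exists2 g, nnint (fun y tau => (um y tau)%:E) = g%:E & 0 <= g.
  by apply: fin => // y tau; rewrite /um ge_max absK -normrN ler_norm normr_ge0.
have [k kE] : exists k, kern_tail s x0 t0 r = k%:E.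
  exists (fine (kern_tail s x0 t0 r)); rewrite fineK// ge0_fin_numE.
    rewrite kern_tail_scaling// lte_mul_pinfty ?lee_fin ?powR_ge0//.
    exact: kern_tail_fin.
  by apply: nnint_ge0 => y tau; rewrite lee_fin; exact: K0.
have Mp : 0 <= Num.max M 0 by rewrite le_max lexx orbT.
have Mm : 0 <= Num.max (- M) 0 by rewrite le_max lexx orbT.
have ZK c : 0 <= c -> nnint (fun y tau => (c * K y tau)%:E) = (c * k)%:E.
  by move=> c0; rewrite nnintZ// -kern_tailE kE -EFinM.
(* Every negative part is moved to the other side: M^+ K + (uK)^- = (M - u) K + (uK)^+ + M^- K. All
   terms are nonnegative, so additivity applies without subtracting infinities. *)
have I : (nnint (fun y tau => (Num.max M 0 * K y tau + um y tau)%:E) =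
    nnint (fun y tau => (D r y tau + (up y tau + Num.max (- M) 0 * K y tau))%:E))%E.
  congr nnint; apply/funext => y; apply/funext => tau; congr EFin.
  rewrite /D -/K -/M /up /um !maxEle; have := K0 y tau; move: (K y tau) (u y tau) => a b a0.
  by do ! case: leP => ?; nra.
move: I; rewrite nnintD//; last 2 first.
- exact: jmeasurableZ.
- by move=> y tau; rewrite mulr_ge0.
rewrite nnintD//; last 2 first.
- by apply: jmeasurableD => //; exact: jmeasurableZ.
- by move=> y tau; rewrite addr_ge0// mulr_ge0.
rewrite nnintD//; last 2 first.
- exact: jmeasurableZ.
- by move=> y tau; rewrite mulr_ge0.
rewrite !ZK// pE mE -!EFinD => I.
(* The left side of the identity is finite, which forces the integral of (M - u) K to be finite
   too. *)
have [d dE] : exists d, nnint (fun y tau => (D r y tau)%:E) = d%:E.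
  by move: I; case: (nnint _) => // d _; exists d.
exists d, p, m, k; split => //.
- have FE : (fun y tau => if (tau <= t0 - r ^+ 2) && (r ^+ 2 <= sqn (x0 - y))
      then u y tau * hkern s x0 t0 y tau else 0) = (fun y tau => u y tau * K y tau).
    apply/funext => y; apply/funext => tau; rewrite /K /tail_kernel.
    by case: ifP; rewrite ?mulr0.
  by rewrite /tail_int FE /sint pE mE.
- have ME : M = Num.max M 0 - Num.max (- M) 0 by rewrite !maxEle; do ! case: leP => ?; lra.
  by move: I; rewrite dE -EFinD => -[]; rewrite [X in X * k = _]ME mulrBl; lra.
Qed.

End maximum_point.

Theorem theorem1p2 (R : realType) (n : nat) (s eps : R)
    (u : 'rV[R]_n -> R -> R) (x0 : 'rV[R]_n) (t0 : R) :
  (0 < n)%N -> 0 < s < 1 -> 0 < eps < 1 ->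
  ParHolderLoc ((2 * s + eps) / 2) u ->
  classL s u ->
  (forall (y : 'rV[R]_n) (tau : R), tau <= t0 -> u y tau <= u x0 t0) ->
  forall r : R, 0 < r ->
    ((u x0 t0)%:E <= (C0 n s / Cns n s * r `^ (2 * s))%:E * fracheat s u x0 t0
                      + (C0 n s * r `^ (2 * s))%:E * tail_int s u x0 t0 r)%E /\
    ((C0 n s * r `^ (2 * s))%:E * kern_tail s x0 t0 r = 1)%E.
Proof.
move=> n0 s01 eps01 uH uL u_max r r0.
have /andP[s0 _] := s01; have /andP[eps0 _] := eps01.
have CK := C0_kern_tail x0 t0 n0 s0 r0; split; last exact: CK.
have ju : st_measurable u by apply: parholder_st_measurable uH; lra.
have [d [p [m [k [dE tE kE I]]]]] := nnint_tail_identity u_max r0 s0 ju uL.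
have := tail_le_lim s u_max r0; rewrite dE => dL.
have C0p := C0_gt0 n0 s0; have Cp := Cns_gt0 s01 n.
have c0 : 0 < C0 n s * r `^ (2 * s) by rewrite mulr_gt0 ?powR_gt0.
have cC : C0 n s / Cns n s * r `^ (2 * s) = C0 n s * r `^ (2 * s) / Cns n s by rewrite mulrAC.
move: CK; rewrite kE -EFinM => -[ck]; rewrite tE /fracheat cC.
move: c0 ck; set c := C0 n s * _ => c0 ck.
(* The factor [Cns] of [fracheat] cancels. The remaining limit may be infinite, so it is only
   bounded below by [d], with all other terms real. *)
rewrite muleA -EFinM divfK ?lt0r_neq0//.
apply: (@le_trans _ _ (c%:E * d%:E + c%:E * (p - m)%:E)%E); last first.
  by rewrite leeD2r// lee_wpmul2l// lee_fin ltW.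
(* Here c (d + p - m) = c M k = M, since c k = 1 is the normalization. *)
by rewrite -!EFinM -EFinD lee_fin -mulrDr addrA -I mulrCA ck mulr1.
Qed.
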